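(* Let $m\in\mathbb{N}$ and $-1<\alpha<0$. For $k\in\mathbb{N}$, $$\left(L_{m,m+k}^{\mathrm{III},\alpha}(x)\right)'=(m+k)L_{k-1}^{\alpha+1}(x)L_m^{-\alpha-1}(-x).$$ In particular, for all $k\in\mathbb{N}$, the Type III exceptional $X_m$-Laguerre polynomial $L_{m,m+k}^{\mathrm{III},\alpha}(x)$ has a local extremum at each of the $m$ roots of $L_m^{-\alpha-1}(-x)$ and at each of the $k-1$ roots of $L_{k-1}^{\alpha+1}(x)$.
   Context: $\mathbb{N}=\{1,2,\dots\}$. For $a\in\mathbb{R}$ and integer $n\ge0$ the classical Laguerre polynomial is $L_n^a(x)=\sum_{j=0}^n\binom{n+a}{n-j}\frac{(-x)^j}{j!}$, with $\binom{r}{i}=r(r-1)\cdots(r-i+1)/i!$; $L_n^a:=0$ for $n<0$. The Type III exceptional $X_m$-Laguerre polynomials are $L_{m,0}^{\mathrm{III},\alpha}(x)=1$ and, for $n\ge m+1$, $$L_{m,n}^{\mathrm{III},\alpha}(x)=xL_{n-m-2}^{\alpha+2}(x)L_m^{-\alpha-1}(-x)+(m+1)L_{n-m-1}^{\alpha+1}(x)L_{m+1}^{-\alpha-2}(-x).$$ *)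

(* Defs.v *)
From HB Require Import structures.
From mathcomp Require Import all_boot all_order all_algebra.
From mathcomp Require Import all_classical all_reals all_analysis.

Set Implicit Arguments.
Unset Strict Implicit.
Unset Printing Implicit Defensive.

Import Order.TTheory GRing.Theory Num.Theory.
Import numFieldNormedType.Exports.

Local Open Scope classical_set_scope.
Local Open Scope ring_scope.

Definition gbinom (R : realType) (r : R) (i : nat) : R :=
  (\prod_(j < i) (r - j%:R)) / i`!%:R.

(* The degree is an integer, so that L_n^a = 0 for n < 0 is not lost to the
   truncated subtraction of nat. *)
Definition laguerre (R : realType) (a : R) (n : int) : {poly R} :=
  match n with
  | Posz n =>
      \sum_(j < n.+1) (gbinom (n%:R + a) (n - j) / j`!%:R) *: (- 'X) ^+ j
  | Negz _ => 0
  end.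

(* Only the degrees n = 0 and n >= m + 1 are meaningful; for 1 <= n <= m the
   value is 0. *)
Definition XLaguerre3 (R : realType) (m : nat) (alpha : R) (n : nat) :
    {poly R} :=
  if n == 0%N then 1
  else 'X * laguerre (alpha + 2) (n%:Z - m%:Z - 2)
          * (laguerre (- alpha - 1) m%:Z \Po (- 'X))
     + (m.+1)%:R *: (laguerre (alpha + 1) (n%:Z - m%:Z - 1)
          * (laguerre (- alpha - 2) (m.+1)%:Z \Po (- 'X))).

Definition local_extremum (R : realType) (f : R -> R) (x : R) : Prop :=
  (\forall y \near x, f y <= f x) \/ (\forall y \near x, f x <= f y).

(* Main.v *)
Require Import Defs.
From HB Require Import structures.
From mathcomp Require Import all_boot all_order all_algebra.
From mathcomp Require Import all_classical all_reals all_analysis.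
From mathcomp Require Import ring lra.
From mathcomp Require polyrcf.

(** The derivative formula is an identity between polynomials.  For k >= 1 the
    exceptional polynomial of index m+k is - x A' B + (m+1) A C, where A is a
    Laguerre polynomial in x and B, C are Laguerre polynomials in -x with C' = B.
    Differentiating it and eliminating x A'' and (m+1) C by the Laguerre equation
    ([laguerre_ode], and [laguerre_opp_ode] for the argument -x) leaves a multiple
    of A B ([deriv_XLaguerre3]).  The equation itself is checked on coefficients.

    For the extrema, -1 < alpha < 0 makes both parameters alpha + 1 and
    -alpha - 1 larger than -1.  For a parameter a > -1 the polynomial L_n^a has n
    simple positive roots ([laguerre_simple_roots]).  This is usually deduced from
    orthogonality; here it is proved without integrals, by induction on n: the
    relation (n+1) L_(n+1) = x L_n' + (n+1+a-x) L_n ([laguerre_succ]) shows that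
    the signs of L_(n+1) alternate along 0, the roots of L_n, and infinity, so the
    intermediate value theorem yields n+1 roots ([laguerre_roots]).

    Hence A has k-1 simple positive roots and B has m simple negative ones.  No
    root is shared, so each is a simple root of the derivative and the second
    derivative does not vanish there; it is therefore a local extremum
    ([local_extremum_horner]). *)

Import Order.TTheory GRing.Theory Num.Theory.
Import numFieldNormedType.Exports.

Local Open Scope classical_set_scope.
Local Open Scope ring_scope.

(** * Generalized binomial coefficients *)

Lemma gbinom0 (R : realType) (r : R) : gbinom r 0 = 1.
Proof. by rewrite /gbinom big_ord0 fact0 divr1. Qed.

Lemma gbinomS (R : realType) (r : R) (i : nat) :
  i.+1%:R * gbinom r i.+1 = (r - i%:R) * gbinom r i.
Proof.
rewrite /gbinom big_ord_recr /= factS natrM.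
have h1 : i%:R + 1 != 0 :> R by rewrite natr1 pnatr_eq0.
have h2 : i`!%:R != 0 :> R by rewrite pnatr_eq0 -lt0n fact_gt0.
by field; rewrite ?(addrC 1) ?h1 ?h2.
Qed.

(** The absorption identity: raising both arguments of a binomial coefficient
    by one is what relates L_n and L_(n+1) with the same parameter. *)
Lemma gbinomSS (R : realType) (r : R) (i : nat) :
  i.+1%:R * gbinom (r + 1) i.+1 = (r + 1) * gbinom r i.
Proof.
rewrite /gbinom big_ord_recl /= factS natrM subr0.
have h1 : i%:R + 1 != 0 :> R by rewrite natr1 pnatr_eq0.
have h2 : i`!%:R != 0 :> R by rewrite pnatr_eq0 -lt0n fact_gt0.
under eq_bigr => j _ do
  rewrite /bump /= add1n -natr1 opprD addrACA subrr addr0.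
by field; rewrite ?(addrC 1) ?h1 ?h2.
Qed.

Lemma gbinom_gt0 (R : realType) (r : R) (i : nat) :
  i%:R < r + 1 -> 0 < gbinom r i.
Proof.
move=> hr; rewrite /gbinom divr_gt0 ?ltr0n ?fact_gt0 //.
apply: prodr_gt0 => j _; rewrite subr_gt0.
have : (j.+1%:R <= i%:R :> R) by rewrite ler_nat.
by rewrite -natr1; lra.
Qed.

(** * Coefficients of Laguerre polynomials *)

Lemma coef_laguerre (R : realType) (a : R) (n j : nat) :
  (laguerre a n)`_j =
    if (j <= n)%N then (-1) ^+ j * gbinom (n%:R + a) (n - j) / j`!%:R else 0.
Proof.
have -> : laguerre a n = \poly_(i < n.+1)
    ((-1) ^+ i * gbinom (n%:R + a) (n - i) / i`!%:R).
  rewrite /laguerre poly_def; apply: eq_bigr => i _.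
  rewrite -scaleN1r exprZn scalerA; congr (_ *: _); ring.
by rewrite coef_poly ltnS.
Qed.

(** The top coefficient (-1)^n / n! is never zero, so the degree is exactly n for
    every real parameter, negative integers included. *)
Lemma size_laguerre (R : realType) (a : R) (n : nat) :
  size (laguerre a n) = n.+1.
Proof.
apply/eqP; rewrite eqn_leq; apply/andP; split.
  by apply/leq_sizeP => j hj; rewrite coef_laguerre leqNgt hj.
rewrite ltnNge; apply/negP => /leq_sizeP /(_ n (leqnn n)) /eqP.
rewrite coef_laguerre leqnn subnn gbinom0 mulr1 mulf_eq0 invr_eq0 pnatr_eq0.
by rewrite signr_eq0 -leqn0 leqNgt fact_gt0.
Qed.

Lemma lead_coef_laguerre (R : realType) (a : R) (n : nat) :
  lead_coef (laguerre a n) = (-1) ^+ n / n`!%:R.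
Proof.
by rewrite lead_coefE size_laguerre coef_laguerre leqnn subnn gbinom0 mulr1.
Qed.

(** L_n(0) = C(n + a, n), and a > -1 makes every factor of it positive. *)
Lemma laguerre_at0_gt0 (R : realType) (a : R) (n : nat) :
  -1 < a -> 0 < (laguerre a n).[0].
Proof.
move=> ha; rewrite horner_coef0 coef_laguerre leq0n expr0 mul1r subn0 fact0.
by rewrite divr1 gbinom_gt0 //; lra.
Qed.

(** The differential equation read off coefficientwise; it comes from
    C(r, i+1) = C(r, i) (r - i) / (i + 1) at r = n + a, i = n - j - 1.  No
    factor is inverted, so that it holds for all real a and also at and beyond
    the degree. *)
Lemma laguerre_coef_step (R : realType) (a : R) (n j : nat) :
  j.+1%:R * (j.+1%:R + a) * (laguerre a n)`_j.+1 =
    (j%:R - n%:R) * (laguerre a n)`_j.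
Proof.
rewrite !coef_laguerre; case: (ltngtP j n) => [ltjn|_|->]; last 2 first.
- by rewrite !mulr0.
- by rewrite mulr0 subrr mul0r.
have := gbinomS _ (n%:R + a) (n - j.+1).
rewrite subnSK // (natrB _ ltjn) (natrB _ (ltnW ltjn)) -(natr1 j) factS natrM exprS.
have h1 : j%:R + 1 != 0 :> R by rewrite natr1 pnatr_eq0.
have h2 : j`!%:R != 0 :> R by rewrite pnatr_eq0 -lt0n fact_gt0.
rewrite -(natr1 j) => e.
transitivity (- ((-1) ^+ j / j`!%:R *
   ((n%:R + a - (n%:R - (j%:R + 1))) * gbinom (n%:R + a) (n - j.+1)))).
  by field; rewrite ?(addrC 1) ?h1 ?h2.
by rewrite -e; ring.
Qed.

Lemma laguerre_coef_succ (R : realType) (a : R) (n j : nat) : (j <= n)%N ->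
  (n.+1%:R - j%:R) * (laguerre a n.+1)`_j =
    (n.+1%:R + a) * (laguerre a n)`_j.
Proof.
move=> lejn; rewrite !coef_laguerre lejn (leqW lejn).
have := gbinomSS _ (n%:R + a) (n - j).
rewrite subSn // -natrB ?leqW // subSn // -(natr1 n).
rewrite (addrAC n%:R a) => e.
transitivity ((-1) ^+ j / j`!%:R *
   ((n - j).+1%:R * gbinom (n%:R + 1 + a) (n - j).+1)); first by ring.
by rewrite e; ring.
Qed.

(** * Differential relations for Laguerre polynomials *)

Lemma deriv_laguerre (R : realType) (a : R) (n : int) :
  (laguerre a n)^`() = - laguerre (a + 1) (n - 1).
Proof.
case: n => [[|n]|n]; last by rewrite /= deriv0 oppr0.
  by rewrite /laguerre big_ord1 expr0 alg_polyC derivC oppr0.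
rewrite (_ : Posz n.+1 - 1 = n); last by rewrite -addn1 PoszD addrK.
apply/polyP => j; rewrite coef_deriv coefN !coef_laguerre ltnS subSS.
case: ifP => _; last by rewrite mul0rn oppr0.
have h1 : j%:R + 1 != 0 :> R by rewrite natr1 pnatr_eq0.
have h2 : j`!%:R != 0 :> R by rewrite pnatr_eq0 -lt0n fact_gt0.
rewrite -[LHS]mulr_natr (_ : n.+1%:R + a = n%:R + (a + 1)).
  rewrite factS natrM -(natr1 j) exprS.
  by field; rewrite ?(addrC 1) ?h1 ?h2.
rewrite -(natr1 n); ring.
Qed.

Lemma deriv_laguerreS (R : realType) (a : R) (n : nat) :
  (laguerre a n.+1)^`() = - laguerre (a + 1) n.
Proof. by rewrite deriv_laguerre -addn1 PoszD addrK. Qed.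

(** x L'' + (a + 1 - x) L' + n L = 0, since the coefficient of x^j on the left
    is the two-term relation between the coefficients j and j+1. *)
Lemma laguerre_ode (R : realType) (a : R) (n : nat) :
  'X * (laguerre a n)^`()^`() + ((a + 1)%:P - 'X) * (laguerre a n)^`()
    + n%:R *: laguerre a n = 0.
Proof.
apply/polyP => j; rewrite mulrBl coef0 !coefD coefN !coefXM coefCM coefZ.
have := laguerre_coef_step _ a n j.
case: j => [|j] /=; rewrite !coef_deriv => e.
  by rewrite mulr1n; lra.
rewrite -[_ *+ j.+1]mulr_natr -[_ *+ j.+2]mulr_natr -[_ *+ j.+1]mulr_natr.
by rewrite -(natr1 j.+1) -(natr1 j) in e *; lra.
Qed.

(** The raising relation.  Analytically it is the Rodrigues step
    (x^(n+1+a) e^(-x) L_n)' = (n+1) x^(n+a) e^(-x) L_(n+1).  It keeps the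
    parameter fixed and its derivative term alone survives at a root of L_n,
    which is what the induction on real roots needs. *)
Lemma laguerre_succ (R : realType) (a : R) (n : nat) :
  n.+1%:R *: laguerre a n.+1 =
    'X * (laguerre a n)^`() + ((n.+1%:R + a)%:P - 'X) * laguerre a n.
Proof.
apply/polyP => j; rewrite mulrBl !coefD coefN !coefXM coefCM coefZ.
have [lejn|ltnj] := leqP j n; last first.
  case: j ltnj => // j; rewrite ltnS /= => lenj.
  rewrite coef_deriv (_ : (laguerre a n)`_j.+1 = 0) ?mul0rn ?mulr0 ?add0r.
    rewrite !coef_laguerre ltnS; case: ltngtP lenj => // [_ _|<- _].
      by rewrite mulr0 oppr0.
    rewrite !subnn !gbinom0 factS natrM exprS.
    have h1 : n%:R + 1 != 0 :> R by rewrite natr1 pnatr_eq0.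
    have h2 : n`!%:R != 0 :> R by rewrite pnatr_eq0 -lt0n fact_gt0.
    by field; rewrite ?(addrC 1) ?h1 ?h2.
  by rewrite coef_laguerre leqNgt ltnS lenj.
have h : n.+1%:R - j%:R != 0 :> R.
  by rewrite subr_eq0 eqr_nat gtn_eqF // ltnS.
apply: (mulfI h); rewrite mulrCA (laguerre_coef_succ _ _ _ _ lejn).
case: j lejn h => [|j] _ _; first by move: (laguerre a n) => p /=; ring.
have := laguerre_coef_step _ a n j; rewrite coef_deriv.
move: (laguerre a n) => p /=; rewrite -[p`_j.+1 *+ j.+1]mulr_natr.
by rewrite -(natr1 j) -(natr1 n) => e; lra.
Qed.

Lemma comp_polyN (R : comNzRingType) (p q : {poly R}) :
  (- p) \Po q = - (p \Po q).
Proof. by rewrite -scaleN1r comp_polyZ scaleN1r. Qed.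

(** The sign of the inner derivative cancels the sign in the derivative
    - L_n^(a+1) of L_(n+1)^a. *)
Lemma deriv_laguerre_opp (R : realType) (a : R) (n : nat) :
  (laguerre a n.+1 \Po - 'X)^`() = laguerre (a + 1) n \Po - 'X.
Proof.
by rewrite deriv_comp deriv_laguerreS !poly.derivE mulrN1 comp_polyN opprK.
Qed.

(** The differential equation at -x, rewritten with first derivatives of the
    lower polynomial; this expresses the factor of degree m+1 in the exceptional
    polynomial through the factor of degree m and its derivative. *)
Lemma laguerre_opp_ode (R : realType) (a : R) (n : nat) :
  n.+1%:R *: (laguerre a n.+1 \Po - 'X) =
    'X * (laguerre (a + 1) n \Po - 'X)^`()
    + ((a + 1)%:P + 'X) * (laguerre (a + 1) n \Po - 'X).
Proof.
have := congr1 (comp_poly (- 'X)) (laguerre_ode _ a n.+1).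
rewrite deriv_laguerreS derivN comp_poly0 !comp_polyD !comp_polyM comp_polyB.
rewrite comp_polyZ !comp_polyN !comp_polyX comp_polyC deriv_comp !poly.derivE.
by move/eqP; rewrite addrC addr_eq0 => /eqP ->; ring.
Qed.

(** * The derivative of the exceptional polynomials *)

(** With A = L_k^(alpha+1), B = L_m^(-alpha-1)(-x), C = L_(m+1)^(-alpha-2)(-x),
    the polynomial is - x A' B + (m+1) A C and C' = B.  The equation of A removes
    x A'', the one of C turns (m+1) C into x B' + (x - alpha - 1) B, and all
    multiples of A' cancel, leaving (k + m + 1) A B. *)
Lemma deriv_XLaguerre3 (R : realType) (m : nat) (alpha : R) (k : nat) :
  (XLaguerre3 m alpha (m + k.+1))^`() =
    (m + k.+1)%:R *: (laguerre (alpha + 1) k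
                      * (laguerre (- alpha - 1) m \Po - 'X)).
Proof.
have k1 : (m + k.+1)%:Z - m%:Z - 1 = k by rewrite -addn1 !PoszD; ring.
have k2 : (m + k.+1)%:Z - m%:Z - 2 = k%:Z - 1 by rewrite -addn1 !PoszD; ring.
rewrite /XLaguerre3 ifN ?k1 ?k2; last by rewrite addnS.
have a1 : alpha + 2 = alpha + 1 + 1 by ring.
have a2 : - alpha - 1 = - alpha - 2 + 1 by ring.
rewrite a1 -[laguerre (_ + 1 + 1) _]opprK -deriv_laguerre.
have eA := laguerre_ode _ (alpha + 1) k.
have eC := laguerre_opp_ode _ (- alpha - 2) m.
have dC := deriv_laguerre_opp _ (- alpha - 2) m.
rewrite -a2 in eC dC.
set A := laguerre (alpha + 1) k in eA *.
set B := laguerre (- alpha - 1) m \Po _ in eC dC *.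
set C := laguerre (- alpha - 2) m.+1 \Po _ in eC dC *.
rewrite -!mul_polyC in eA eC *.
have {}eA : 'X * A^`()^`() = - (((alpha + 1 + 1)%:P - 'X) * A^`())
   - k%:R%:P * A.
  by apply/eqP; rewrite -opprD -addr_eq0 addrA eA.
rewrite !poly.derivE dC.
(* The product rule, grouped so that x A'' and (m+1) C can be eliminated. *)
transitivity (- A^`() * B - ('X * A^`()^`()) * B - 'X * A^`() * B^`()
  + A^`() * (m.+1%:R%:P * C) + m.+1%:R%:P * A * B); first by ring.
rewrite eA eC addnS -addSn !natrD !polyCD !polyCN; ring.
Qed.

(** * Real roots of Laguerre polynomials *)

(** The intermediate value theorem on each of the consecutive intervals; the
    induction replaces q by -q so that the first sign is always positive. *)
Lemma alternating_roots (R : realType) (q : {poly R}) (x : R) (s : seq R) :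
  path <%R x s ->
  (forall i, (i <= size s)%N -> 0 < (-1) ^+ i * q.[nth 0 (x :: s) i]) ->
  exists t, [/\ path <%R x t, size t = size s & all (root q) t].
Proof.
elim: s x q => [|y s IHs] x q /=; first by exists [::].
move=> /andP[ltxy ys] sgn.
have [|t [yt szt rt]] := IHs y (- q) ys.
  move=> i lei; have := sgn i.+1 lei.
  by rewrite /= hornerN exprS mulN1r mulNr mulrN.
have [|r] := @polyrcf.poly_ivtoo R q x y (ltW ltxy).
  have := sgn 0%N isT; have := sgn 1%N isT.
  rewrite /= expr0 expr1 mul1r mulN1r oppr_gt0 => y0 x0.
  by rewrite pmulr_rlt0.
rewrite in_itv /= => /andP[ltxr ltry] rr.
exists (r :: t); split=> /=; last 2 first.
- by rewrite szt.
- by rewrite rr; apply: sub_all rt => z; rewrite rootN.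
by rewrite ltxr (path_le lt_trans ltry).
Qed.

(** The slopes at consecutive simple roots alternate.  Writing the factors as
    z - X rather than X - z makes the sign depend only on the index i and not on
    the number of roots: removing the smallest root y divides the slope at a
    later root s_i by y - s_i < 0 and lowers the index by one. *)
Lemma sgn_deriv_prod (R : realType) (s : seq R) (i : nat) :
  sorted <%R s -> (i < size s)%N ->
  0 < (-1) ^+ i.+1 * (\prod_(z <- s) (z%:P - 'X))^`().[s`_i].
Proof.
elim: s i => [|y s IHs] i //= ys.
have /allP gty := lt_path_min ys.
rewrite big_cons derivM derivB derivC derivX sub0r hornerD !hornerM.
rewrite !hornerE /=.
case: i => [_|i lti] /=.
  rewrite subrr mul0r addr0 expr1 mulN1r mulN1r opprK horner_prod big_seq.
  by apply: prodr_gt0 => z /gty; rewrite !hornerE subr_gt0.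
have -> : (\prod_(z <- s) (z%:P - 'X)).[s`_i] = 0.
  rewrite horner_prod; apply/eqP; rewrite prodf_seq_eq0.
  by apply/hasP; exists s`_i; rewrite ?mem_nth //= !hornerE subrr.
rewrite mulr0 add0r exprS mulrCA mulN1r mulNr mulrN -mulNr opprB.
by rewrite mulr_gt0 ?IHs ?(path_sorted ys) // subr_gt0 gty ?mem_nth.
Qed.

(** Evaluation at 0 shows that the constant is positive, since all the factors
    z - 0 are. *)
Lemma prod_of_positive_roots (R : realType) (p : {poly R}) (s : seq R) :
  0 < p.[0] -> path <%R 0 s -> size p = (size s).+1 -> all (root p) s ->
  exists2 c, 0 < c & p = c *: \prod_(z <- s) (z%:P - 'X).
Proof.
move=> p0 s0 szp rp.
have us : uniq s by have := lt_sorted_uniq (path_sorted s0).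
have /allP gt0 := lt_path_min s0.
pose c := lead_coef p * (-1) ^+ size s.
have pE : p = c *: \prod_(z <- s) (z%:P - 'X).
  rewrite {1}(all_roots_prod_XsubC szp rp) ?uniq_rootsE // /c -scalerA.
  congr (_ *: _); elim: (s) => [|z r IHr]; first by rewrite !big_nil scale1r.
  by rewrite !big_cons IHr /= exprS mulN1r scaleNr -scalerAr -scalerN -mulNr opprB.
exists c => //; move: p0; rewrite pE hornerZ horner_prod pmulr_lgt0 //.
by rewrite big_seq; apply: prodr_gt0 => z /gt0; rewrite !hornerE subr0.
Qed.

(** Induction by interlacing.  Let x_0 < ... < x_(n-1) be the roots of L_n.  By
    the raising relation L_(n+1) has at x_i the sign of L_n'(x_i), namely
    (-1)^(i+1); it is positive at 0 because a > -1, and has sign (-1)^(n+1) near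
    infinity.  Hence it changes sign on each of the n+1 intervals cut out of
    the positive axis by these points. *)
Lemma laguerre_roots (R : realType) (a : R) (n : nat) : -1 < a ->
  exists s, [/\ path <%R 0 s, size s = n & all (root (laguerre a n)) s].
Proof.
move=> ha; elim: n => [|n [s [s0 szs rs]]]; first by exists [::].
have [c c0 pE] := prod_of_positive_roots _ _ _ (laguerre_at0_gt0 _ _ n ha) s0
  (etrans (size_laguerre _ a n) (congr1 succn (esym szs))) rs.
set q := laguerre a n.+1.
have lcq : 0 < lead_coef ((-1) ^+ n.+1 *: q).
  rewrite lead_coefZ lead_coef_laguerre mulrA -exprD addnn -signr_odd.
  by rewrite odd_double mul1r invr_gt0 ltr0n fact_gt0.
(* A point beyond all roots of L_n where the leading term of L_(n+1) decides
   the sign closes the last interval. *)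
have [M [ltM qM]] : exists M, last 0 s < M /\ 0 < (-1) ^+ n.+1 * q.[M].
  have [N HN] := polyrcf.poly_pinfty_gt_lc lcq.
  exists (Num.max N (last 0 s + 1)); rewrite lt_max ltrDl ltr01 orbT; split=> //.
  have := HN (Num.max N (last 0 s + 1)); rewrite le_max lexx hornerZ => /(_ isT).
  exact: lt_le_trans.
have [||t [t0 szt rt]] := alternating_roots _ q 0 (rcons s M).
- by rewrite rcons_path s0.
- rewrite size_rcons szs => -[|i] /=.
    by rewrite mul1r laguerre_at0_gt0.
  rewrite ltnS leq_eqVlt nth_rcons szs => /predU1P[->|lti].
    by rewrite ltnn eqxx.
  rewrite lti; set x := s`_i.
  have xs : x \in s by rewrite mem_nth // szs.
  have x0 : 0 < x by have /allP := lt_path_min s0; apply.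
  have n0 : 0 < n.+1%:R :> R by rewrite ltr0n.
  (* At a root of L_n only the derivative term of laguerre_succ survives. *)
  have qx : n.+1%:R * q.[x] = x * (laguerre a n)^`().[x].
    rewrite -hornerZ laguerre_succ hornerD !hornerM hornerX.
    by have /allP/(_ x xs)/rootP-> := rs; rewrite mulr0 addr0.
  rewrite -(pmulr_rgt0 _ n0) mulrCA qx mulrCA pmulr_rgt0 //.
  rewrite pE derivZ hornerZ mulrCA pmulr_rgt0 //.
  by rewrite sgn_deriv_prod ?szs ?(path_sorted s0).
- by exists t; rewrite szt size_rcons szs.
Qed.

(** All n roots are accounted for, so L_n is a constant multiple of the product
    over them, which has no other root and nonzero slope at each. *)
Lemma laguerre_simple_roots (R : realType) (a : R) (n : nat) : -1 < a ->
  exists s, [/\ uniq s, size s = n,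
    (forall x, root (laguerre a n) x = (x \in s)) &
    (forall x, x \in s -> 0 < x /\ (laguerre a n)^`().[x] != 0)].
Proof.
move=> ha; have [s [s0 szs rs]] := laguerre_roots _ a n ha.
have [c c0 pE] := prod_of_positive_roots _ _ _ (laguerre_at0_gt0 _ _ n ha) s0
  (etrans (size_laguerre _ a n) (congr1 succn (esym szs))) rs.
exists s; split=> //.
- exact: lt_sorted_uniq (path_sorted s0).
- move=> x; apply/idP/idP => [|xs]; last by have /allP := rs; apply.
  rewrite rootE pE hornerZ mulf_eq0 (gt_eqF c0) /= horner_prod prodf_seq_eq0.
  by case/hasP => z zs /=; rewrite !hornerE subr_eq0 => /eqP <-.
move=> x xs; split; first by have /allP := lt_path_min s0; apply.
have := xs; rewrite -index_mem => lti.
have := sgn_deriv_prod _ s _ (path_sorted s0) lti; rewrite nth_index //.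
rewrite pE derivZ hornerZ mulf_eq0 (gt_eqF c0) /=.
by apply: contraTneq => ->; rewrite mulr0 ltxx.
Qed.

(** * Local extrema *)

(** The second derivative test.  Dividing twice by X - x gives
    p = p(x) + g (X - x)^2 with p''(x) = 2 g(x), and g keeps its sign near x by
    continuity, so p - p(x) does too. *)
Lemma local_extremum_horner (R : realType) (p : {poly R}) (x : R) :
  p^`().[x] = 0 -> p^`()^`().[x] != 0 -> local_extremum (horner p) x.
Proof.
move=> p1 p2.
have /factor_theorem [h hE] : root (p - p.[x]%:P) x.
  by rewrite rootE !hornerE subrr.
have pE : p = p.[x]%:P + h * ('X - x%:P) by rewrite -hE addrC subrK.
have /factor_theorem [g gE] : root h x.
  rewrite rootE -p1 pE !poly.derivE !hornerE /=; apply/eqP; ring.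
rewrite gE in pE.
have p2E : p^`()^`().[x] = 2 * g.[x].
  rewrite pE !poly.derivE !hornerE /=; ring.
have pyE y : p.[y] = p.[x] + g.[y] * (y - x) ^+ 2.
  rewrite {1}pE !hornerE /=; ring.
rewrite p2E mulf_eq0 negb_or pnatr_eq0 /= in p2.
have gx : horner g y @[y --> x] --> g.[x] := @continuous_horner R g x.
case: (ltgtP g.[x] 0) p2 => // g0 _; [left|right].
- near=> y; rewrite (pyE y) gerDl nmulr_rle0 ?sqr_ge0 //.
  by near: y; exact: (cvgr_lt _ gx).
- near=> y; rewrite (pyE y) lerDl pmulr_rge0 ?sqr_ge0 //.
  by near: y; exact: (cvgr_gt _ gx).
Unshelve. all: by end_near.
Qed.

(** A simple root of p' coming from exactly one of its two factors. *)
Lemma local_extremum_deriv_mul (R : realType) (c : R) (p f g : {poly R})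
    (x : R) :
  c != 0 -> p^`() = c *: (f * g) -> f.[x] = 0 -> f^`().[x] != 0 ->
  g.[x] != 0 -> local_extremum (horner p) x.
Proof.
move=> c0 dp fx dfx gx; apply: local_extremum_horner; rewrite dp.
  by rewrite hornerZ hornerM fx mul0r mulr0.
rewrite derivZ derivM hornerZ hornerD !hornerM fx mul0r addr0.
by rewrite !mulf_neq0.
Qed.

Theorem lemma5p3 (R : realType) (m : nat) (alpha : R)
    (hm : (1 <= m)%N) (halpha : -1 < alpha < 0) :
  (forall k : nat, (1 <= k)%N ->
     (XLaguerre3 m alpha (m + k))^`() =
       (m + k)%:R *: (laguerre (alpha + 1) (k%:Z - 1)
                      * (laguerre (- alpha - 1) m%:Z \Po (- 'X)))) /\
  (forall k : nat, (1 <= k)%N ->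
     (exists s : seq R,
        [/\ uniq s, size s = m,
            (forall x : R,
               root (laguerre (- alpha - 1) m%:Z \Po (- 'X)) x = (x \in s)) &
            (forall x : R, x \in s ->
               local_extremum (horner (XLaguerre3 m alpha (m + k))) x)]) /\
     (exists t : seq R,
        [/\ uniq t, size t = (k - 1)%N,
            (forall x : R,
               root (laguerre (alpha + 1) (k%:Z - 1)) x = (x \in t)) &
            (forall x : R, x \in t ->
               local_extremum (horner (XLaguerre3 m alpha (m + k))) x)])).
Proof.
have /andP[a_gtN1 a_lt0] := halpha.
have dX k : (1 <= k)%N -> (XLaguerre3 m alpha (m + k))^`() =
    (m + k)%:R *: (laguerre (alpha + 1) (k%:Z - 1)
                   * (laguerre (- alpha - 1) m%:Z \Po (- 'X))).
  by case: k => // k _; rewrite deriv_XLaguerre3 -[k.+1]addn1 PoszD addrK.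
split=> // k k1; have := dX k k1.
case: k k1 => // k _.
have -> : k.+1%:Z - 1 = k by rewrite -[k.+1]addn1 PoszD addrK.
rewrite subSS subn0 => {}dX.
have a1 : -1 < alpha + 1 by lra.
have a2 : -1 < - alpha - 1 by lra.
have c0 : (m + k.+1)%:R != 0 :> R by rewrite pnatr_eq0 addnS.
have [t [ut szt rt simplet]] := laguerre_simple_roots _ (alpha + 1) k a1.
have [s [us szs rs simples]] := laguerre_simple_roots _ (- alpha - 1) m a2.
have hornerNX (p : {poly R}) y : (p \Po - 'X).[y] = p.[- y].
  by rewrite horner_comp hornerN hornerX.
split.
  exists [seq - x | x <- s]; split.
  - by rewrite map_inj_uniq //; exact: oppr_inj.
  - by rewrite size_map.
  - move=> x; rewrite rootE hornerNX -rootE rs.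
    by rewrite -{2}[x]opprK mem_map //; exact: oppr_inj.
  move=> _ /mapP[x xs ->]; have [x0 dx] := simples x xs.
  (* -x is a negative root of the second factor, so the first factor, whose
     roots are all positive, does not vanish there. *)
  rewrite mulrC in dX; apply: local_extremum_deriv_mul c0 dX _ _ _.
  - by rewrite hornerNX opprK; apply/rootP; rewrite rs.
  - rewrite deriv_comp hornerM hornerNX opprK derivN derivX !hornerE.
    by rewrite mulrN1 oppr_eq0.
  - rewrite -rootE rt; apply/negP => /simplet[].
    by rewrite oppr_gt0 ltNge ltW.
exists t; split=> // x xt; have [x0 dx] := simplet x xt.
apply: local_extremum_deriv_mul c0 dX _ dx _.
- by apply/rootP; rewrite rt.
- rewrite hornerNX -rootE rs; apply/negP => /simples[].
  by rewrite oppr_gt0 ltNge ltW.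
Qed.
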